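(* Consider the finite-dimensional linear relaxation family $U_t=L_\varepsilon U$, $L_\varepsilon=A+\frac1\varepsilon B_0$, $0<\varepsilon\le\varepsilon_0$. Assume: (i) (spectral splitting) for every $0<\varepsilon\le\varepsilon_0$ there are complementary projectors $\Pi_s(\varepsilon)+\Pi_f(\varepsilon)=I$, $\Pi_s\Pi_f=\Pi_f\Pi_s=0$, both commuting with $L_\varepsilon$, with $\sup_{0<\varepsilon\le\varepsilon_0}(\|\Pi_s(\varepsilon)\|+\|\Pi_f(\varepsilon)\|)\le C_P<\infty$, and $L_s=\Pi_sL_\varepsilon\Pi_s$ satisfies $\sup_{0<\varepsilon\le\varepsilon_0}\|L_s(\varepsilon)\|\le M_L<\infty$; (ii) (uniform slow local defect) there exist $h_0>0$ and $C_\ell>0$, independent of $\varepsilon$, such that $$\|\Pi_sS_\varepsilon\Pi_s-e^{hL_\varepsilon}\Pi_s\|\le C_\ell h^5,\qquad 0<h\le h_0,\ 0<\varepsilon\le\varepsilon_0.$$ Let $R_{\rm SFRC}(h,\varepsilon)=\Pi_sS_\varepsilon\Pi_s+e^{hL_\varepsilon}\Pi_f$. Then for every $T>0$ there is a constant $C_T$, independent of $\varepsilon\in(0,\varepsilon_0]$ and $h\in(0,h_0]$, such that $$\max_{0\le nh\le T}\bigl\|R_{\rm SFRC}(h,\varepsilon)^nU^0-e^{nhL_\varepsilon}U^0\bigr\|\le C_Th^4\|U^0\|.$$ The estimate holds for arbitrary initial data $U^0$.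
   Context: $S_\varepsilon=S(h;A,B_0/\varepsilon)$ is the one-step matrix of the base method, where for square matrices $A,B$ and $L=A+B$ (inverses assumed to exist) $$P_*=\Bigl(I-\tfrac h2B+\tfrac{h^2}{8}BL\Bigr)^{-1}\Bigl(I+\tfrac h2A+\tfrac{h^2}{8}AL\Bigr),$$ $$S(h;A,B)=\Bigl(I-hB+\tfrac{h^2}{6}BL\Bigr)^{-1}\Bigl[I+hA+\tfrac{h^2}{6}AL+\tfrac{h^2}{3}(A-B)LP_*\Bigr].$$ Norms are a fixed vector norm and its induced operator norm; $n$ ranges over nonnegative integers. *)

(* Defs.v *)
From HB Require Import structures.
From mathcomp Require Import all_boot all_order all_algebra.
From mathcomp Require Import all_classical all_reals all_analysis.

Set Implicit Arguments.
Unset Strict Implicit.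
Unset Printing Implicit Defensive.

Import Order.TTheory GRing.Theory Num.Theory.
Import numFieldNormedType.Exports.

Local Open Scope classical_set_scope.
Local Open Scope ring_scope.

(* Scalars are real. Complex matrices are covered as well: C^d is the real
   space R^(2d), a norm on C^d is in particular a norm on R^(2d), and products,
   inverses, exponentials and induced norms are the same for both views. *)

Record is_vector_norm (R : realType) (d : nat) (N : 'cV[R]_d -> R) : Prop := {
  vector_norm_definite : forall x, N x = 0 -> x = 0;
  vector_normZ : forall (a : R) x, N (a *: x) = `|a| * N x;
  vector_norm_triangle : forall x y, N (x + y) <= N x + N y
}.

(* In finite dimension the set below is bounded (and it contains 0), so [sup]
   is a genuine supremum. *)
Definition opnorm (R : realType) (d : nat) (N : 'cV[R]_d -> R) (M : 'M[R]_d)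
    : R :=
  sup [set N (M *m x) | x in [set x : 'cV[R]_d | N x <= 1]].

(* The limit is for the topology of entrywise convergence, in which the series
   converges for every M. *)
Definition expmx (R : realType) (d : nat) (M : 'M[R]_d) : 'M[R]_d :=
  limn (series (fun k : nat => (k`!%:R : R)^-1 *: M ^+ k)).

Definition is_projector (R : realType) (d : nat) (P : 'M[R]_d) : Prop :=
  P *m P = P.

Definition Pstar_den (R : realType) (d : nat) (h : R) (A B : 'M[R]_d)
    : 'M[R]_d :=
  let L := A + B in
  1%:M - (h / 2) *: B + (h ^+ 2 / 8) *: (B *m L).

Definition Pstar (R : realType) (d : nat) (h : R) (A B : 'M[R]_d) : 'M[R]_d :=
  let L := A + B in
  invmx (Pstar_den h A B) *m
    (1%:M + (h / 2) *: A + (h ^+ 2 / 8) *: (A *m L)).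

Definition base_step_den (R : realType) (d : nat) (h : R) (A B : 'M[R]_d)
    : 'M[R]_d :=
  let L := A + B in
  1%:M - h *: B + (h ^+ 2 / 6) *: (B *m L).

Definition base_step (R : realType) (d : nat) (h : R) (A B : 'M[R]_d)
    : 'M[R]_d :=
  let L := A + B in
  invmx (base_step_den h A B) *m
    (1%:M + h *: A + (h ^+ 2 / 6) *: (A *m L)
     + (h ^+ 2 / 3) *: ((A - B) *m L *m Pstar h A B)).

(* [invmx] is the identity on singular matrices, so the formulas above have
   their intended meaning only under this condition. *)
Definition base_step_defined (R : realType) (d : nat) (h : R) (A B : 'M[R]_d)
    : Prop :=
  Pstar_den h A B \in unitmx /\ base_step_den h A B \in unitmx.

Definition relax_gen (R : realType) (d : nat) (A B0 : 'M[R]_d) (eps : R)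
    : 'M[R]_d :=
  A + eps^-1 *: B0.

Definition relax_step (R : realType) (d : nat) (A B0 : 'M[R]_d) (h eps : R)
    : 'M[R]_d :=
  base_step h A (eps^-1 *: B0).

Definition sfrc_step (R : realType) (d : nat) (A B0 : 'M[R]_d)
    (Ps Pf : R -> 'M[R]_d) (h eps : R) : 'M[R]_d :=
  Ps eps *m relax_step A B0 h eps *m Ps eps
  + expmx (h *: relax_gen A B0 eps) *m Pf eps.

(* Main.v *)
Require Import Defs.
From HB Require Import structures.
From mathcomp Require Import all_boot all_order all_algebra.
From mathcomp Require Import ring.
From mathcomp Require Import all_classical all_reals all_analysis.
Import Order.TTheory GRing.Theory Num.Theory.
Import numFieldNormedType.Exports.
Local Open Scope ring_scope.

(** Write E = e^{hL}, P and Q for the slow and fast projectors, and S for the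
    base step, so that R = P S P + E Q. On the range of Q both R and E act as
    E, so the fast part is propagated without error, however stiff it is:
    R^n - E^n lives on the range of P alone.

    On the range of P the norm of E must be bounded uniformly in eps. The norm
    of L itself may blow up as eps -> 0, but L P = P Ls with Ls = P L P bounded by
    ML, hence E P = P G with G = e^{h Ls} and |G| <= e^{h ML}. The slow part of
    R satisfies in the same way R P = P (G + D), where D = P S P - E P is the
    local defect. Therefore (lemma [split_powerB])

      R^n - E^n = P ((G + D)^n - G^n).

    Replacing E P by G, whose norm carries no factor CP, is what makes powers
    harmless: a bound of the form CP e^{h ML} on one step would become
    CP^n e^{nh ML} after n steps. Since |D| <= Cl h^5 <= h (Cl h0^4), both G
    and G + D have norm at most rho = e^{h M} with M = ML + Cl h0^4, and
    telescoping (lemma [opnorm_exprB]) bounds the difference of n-th powers by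
    n |D| rho^n <= (nh) Cl h^4 e^{nh M}. With nh <= T this gives the constant
    CP T Cl e^{T M}.

    Two bodies of theory support this argument. For the matrix exponential:
    convergence, e^{X+Y} = e^X e^Y for commuting X and Y, and the transfer of
    an intertwining relation X P = P Y to exponentials. For an arbitrary vector
    norm: the equivalence with the maximum norm, by compactness of the unit
    sphere, without which the supremum defining the operator norm could be
    infinite; then |e^M| <= e^{|M|}. *)

(** * The maximum norm on matrices *)

(** Together with the maximum norm, this makes matrices a complete normed
    module, where absolutely convergent series converge. *)
HB.instance Definition _ (R : realType) (m n : nat) :=
  Uniform_isComplete.Build 'M[R]_(m, n) (@mx_complete R m n).

Section mx_max_norm.
Local Open Scope classical_set_scope.
Context {R : realType}.

Lemma mx_norm_entry_le {m n : nat} (M : 'M[R]_(m, n)) i j : `|M i j| <= `|M|.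
Proof.
rewrite [leRHS]/Num.norm /= mx_normrE.
exact: (le_bigmax _ (fun ij : 'I_m * 'I_n => `|M ij.1 ij.2|) (i, j)).
Qed.

Lemma mx_norm_le {m n : nat} (M : 'M[R]_(m, n)) (c : R) :
  0 <= c -> (forall i j, `|M i j| <= c) -> `|M| <= c.
Proof.
move=> c0 Mc; rewrite /Num.norm /= mx_normrE.
by apply/bigmax_leP; split => // -[i j] _; exact: Mc.
Qed.

Lemma mx_norm_trmx {m n : nat} (M : 'M[R]_(m, n)) : `|M^T| = `|M|.
Proof.
apply/eqP; rewrite eq_le; apply/andP; split; apply: mx_norm_le => // i j.
  by rewrite mxE mx_norm_entry_le.
by have := mx_norm_entry_le M^T j i; rewrite mxE.
Qed.

Lemma mx_norm_mulmx {m n p : nat} (M : 'M[R]_(m, n)) (P : 'M[R]_(n, p)) :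
  `|M *m P| <= n%:R * `|M| * `|P|.
Proof.
apply: mx_norm_le => [|i j]; first by rewrite !mulr_ge0.
rewrite mxE; apply: le_trans (ler_norm_sum _ _ _) _.
have -> : n%:R * `|M| * `|P| = \sum_(k < n) `|M| * `|P|.
  by rewrite sumr_const card_ord -mulrA mulr_natl.
by apply: ler_sum => k _; rewrite normrM ler_pM ?mx_norm_entry_le.
Qed.

Lemma cvg_mulmx {m n p : nat} (M_ : nat -> 'M[R]_(m, n))
    (P_ : nat -> 'M[R]_(n, p)) (M : 'M[R]_(m, n)) (P : 'M[R]_(n, p)) :
  M_ @ \oo --> M -> P_ @ \oo --> P ->
  (fun k => M_ k *m P_ k) @ \oo --> M *m P.
Proof.
move=> cM cP; apply/subr_cvg0; apply: norm_cvg0.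
apply: (@squeeze_cvgr _ _ _ _ (fun=> 0)
  (fun k => n%:R * `|M_ k - M| * `|P_ k| + n%:R * `|M| * `|P_ k - P|)).
- near=> k; rewrite normr_ge0 /=.
  rewrite (_ : _ - _ = (M_ k - M) *m P_ k + M *m (P_ k - P)); last first.
    by rewrite mulmxBl mulmxBr addrA subrK.
  apply: le_trans (ler_normD _ _) _.
  by apply: lerD; exact: mx_norm_mulmx.
- exact: cvg_cst.
- have <- : n%:R * `|M - M| * `|P| + n%:R * `|M| * `|P - P| = 0.
    by rewrite !subrr !normr0 mulr0 mul0r mulr0 addr0.
  apply: cvgD; apply: cvgM; rewrite //; try apply: cvgM; try exact: cvg_cst.
  + by apply: cvg_norm; apply: cvgB => //; exact: cvg_cst.
  + by apply: cvg_norm.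
  + by apply: cvg_norm; apply: cvgB => //; exact: cvg_cst.
Unshelve. all: by end_near. Qed.
End mx_max_norm.

(** * The exponential of a matrix *)

(** A product of two partial sums of length n runs over the square
    [i, j < n]; the n-th partial sum of the Cauchy product runs over the
    triangle [i + j < n]. What is left is the corner beyond the diagonal. *)
Lemma cauchy_product_tail {V : zmodType} (F : nat -> nat -> V) (n : nat) :
  \sum_(0 <= i < n) \sum_(0 <= j < n) F j i
    - \sum_(0 <= k < n) \sum_(0 <= i < k.+1) F (k - i)%N i
  = \sum_(0 <= i < n) \sum_(0 <= j < n | (n <= i + j)%N) F j i.
Proof.
have -> : \sum_(0 <= k < n) \sum_(0 <= i < k.+1) F (k - i)%N i =
    \sum_(0 <= i < n) \sum_(0 <= j < n | (i + j < n)%N) F j i.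
  under eq_big_nat => k /andP[_ kn] do rewrite (big_nat_widen _ _ _ _ _ kn).
  rewrite (exchange_big_dep_nat predT)//=; apply: eq_big_nat => i /andP[_ ilt].
  rewrite (eq_bigl (fun k => true && (i <= k)%N))//.
  rewrite -big_nat_widenl// -[i]add0n big_addn add0n.
  rewrite (big_nat_widen _ _ _ _ _ (leq_subr i n)).
  apply: eq_big => [j|j _]; first by rewrite ltn_subRL.
  by rewrite addnK.
rewrite -sumrB; apply: eq_bigr => i _.
rewrite (bigID (fun j => i + j < n)%N)/= addrC addrK.
by apply: eq_bigl => j; rewrite -leqNgt.
Qed.

Section matrix_exponential.
Local Open Scope classical_set_scope.
Context {R : realType} {d : nat}.
Implicit Types X Y P : 'M[R]_d.

Local Notation exp_sum X :=
  (series (fun k : nat => (k`!%:R : R)^-1 *: (X : 'M[R]_d) ^+ k)).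

(** The factor [d] of the maximum norm is attached to [X] alone: a bound in
    [d * |X|] and [d * |Y|] with no further constant is what makes the
    comparison with scalar exponentials in [expmxD] exact. *)
Lemma mx_norm_exprM X Y k : `|X ^+ k *m Y| <= (d%:R * `|X|) ^+ k * `|Y|.
Proof.
elim: k => [|k IH]; first by rewrite !expr0 mul1mx mul1r.
rewrite exprS -mulmxE -mulmxA; apply: le_trans (mx_norm_mulmx _ _) _.
by rewrite exprS -[leRHS]mulrA ler_wpM2l// mulr_ge0.
Qed.

Lemma mx_norm_expr X k : `|X ^+ k| <= (d%:R * `|X|) ^+ k.
Proof.
rewrite -[X ^+ k]mulmx1; apply: le_trans (mx_norm_exprM _ _ _) _.
rewrite -[leRHS]mulr1 ler_wpM2l ?exprn_ge0 ?mulr_ge0//.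
by apply: mx_norm_le => // i j; rewrite mxE; case: eqP; rewrite ?normr1 ?normr0.
Qed.

Lemma cvg_expmx X : exp_sum X @ \oo --> expmx X.
Proof.
apply: (@normed_cvg R 'M[R]_d).
apply: (@series_le_cvg _ _ (exp_coeff (d%:R * `|X|))) => [k|k|k|].
- exact: normr_ge0.
- by apply: exp_coeff_ge0; rewrite mulr_ge0.
- rewrite /= normrZ normfV normr_nat mulrC /exp_coeff /=.
  by rewrite ler_wpM2r ?invr_ge0 ?mx_norm_expr.
- exact: is_cvg_series_exp_coeff.
Qed.

Lemma expmx0 : expmx (0 : 'M[R]_d) = 1%:M.
Proof.
apply: (cvg_unique _ (@cvg_expmx 0)) => //.
apply/cvg_ballP => e e0; exists 1%N => // -[//|n] _ /=.
rewrite /series/= big_nat_recl// fact0 invr1 expr0 scale1r big1 ?addr0.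
  exact: ballxx.
by move=> k _; rewrite exprS mul0r scaler0.
Qed.

Lemma expr_intertwine X Y P k : X *m P = P *m Y -> X ^+ k *m P = P *m Y ^+ k.
Proof.
move=> XP; elim: k => [|k IH]; first by rewrite !expr0 mul1mx mulmx1.
by rewrite !exprS -!mulmxE -mulmxA IH mulmxA XP mulmxA.
Qed.

(** With [Y = X] this says that [P] commutes with [expmx X] as soon as it
    commutes with [X]; with [Y = P *m X *m P], where [P] is a projector
    commuting with [X], it computes the exponential of [X] on the range of [P]
    from this compression only. *)
Lemma expmx_intertwine X Y P :
  X *m P = P *m Y -> expmx X *m P = P *m expmx Y.
Proof.
move=> XP.
have cX : (fun n => exp_sum X n *m P) @ \oo --> expmx X *m P.
  by apply: cvg_mulmx; [exact: cvg_expmx|exact: cvg_cst].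
have cY : (fun n => P *m exp_sum Y n) @ \oo --> P *m expmx Y.
  by apply: cvg_mulmx; [exact: cvg_cst|exact: cvg_expmx].
suff eXY : (fun n => exp_sum X n *m P) = (fun n => P *m exp_sum Y n).
  by rewrite -eXY in cY; exact: (cvg_unique _ cX cY).
apply/funext => n; rewrite /series/= mulmx_suml mulmx_sumr.
apply: eq_bigr => k _.
by rewrite -scalemxAl -scalemxAr (expr_intertwine _ _ _ k XP).
Qed.

Let fact_bin (k i : nat) : (i < k.+1)%N ->
  (k`!%:R)^-1 * 'C(k, i)%:R = ((k - i)`!%:R)^-1 * (i`!%:R)^-1 :> R.
Proof.
rewrite ltnS => ik; rewrite -(bin_fact ik) !natrM.
by field; rewrite !pnatr_eq0 -!lt0n !fact_gt0 bin_gt0 ik.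
Qed.

Lemma exp_sum_defect X Y n : comm_mx X Y ->
  exp_sum X n *m exp_sum Y n - exp_sum (X + Y) n =
  \sum_(0 <= i < n) \sum_(0 <= j < n | (n <= i + j)%N)
    ((j`!%:R)^-1 * (i`!%:R)^-1) *: (X ^+ j *m Y ^+ i).
Proof.
move=> XY.
rewrite -(cauchy_product_tail (fun j i =>
  ((j`!%:R)^-1 * (i`!%:R)^-1) *: (X ^+ j *m Y ^+ i)) n).
congr (_ - _).
- rewrite /series /= mulmx_sumr; apply: eq_bigr => i _.
  rewrite mulmx_suml; apply: eq_bigr => j _.
  by rewrite -scalemxAl -scalemxAr scalerA.
- rewrite /series /=; apply: eq_bigr => k _.
  rewrite exprDn_comm// scaler_sumr big_mkord; apply: eq_bigr => i _.
  by rewrite -[_ *+ 'C(k, i)]scaler_nat scalerA fact_bin// mulmxE.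
Qed.

Lemma exp_coeff_defect (x y : R) n :
  series (exp_coeff x) n * series (exp_coeff y) n
    - series (exp_coeff (x + y)) n =
  \sum_(0 <= i < n) \sum_(0 <= j < n | (n <= i + j)%N)
    ((j`!%:R)^-1 * (i`!%:R)^-1) * (x ^+ j * y ^+ i).
Proof.
rewrite -(cauchy_product_tail (fun j i =>
  ((j`!%:R)^-1 * (i`!%:R)^-1) * (x ^+ j * y ^+ i)) n).
congr (_ - _).
- rewrite /series /= mulr_sumr; apply: eq_bigr => i _.
  rewrite mulr_suml; apply: eq_bigr => j _.
  by rewrite /exp_coeff /=; ring.
- rewrite /series /=; apply: eq_bigr => k _; rewrite /exp_coeff /= mulrC.
  rewrite exprDn mulr_sumr big_mkord; apply: eq_bigr => i _.
  by rewrite -[_ *+ 'C(k, i)]mulr_natl [LHS]mulrA fact_bin.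
Qed.

(** By [exp_sum_defect] and [exp_coeff_defect], the corner of the matrix Cauchy
    product is dominated termwise by that of the scalar series at
    [x = d * |X|] and [y = d * |Y|]. The latter tends to
    [e^x * e^y - e^(x + y) = 0], so the functional equation of the real
    exponential yields that of the matrix one. *)
Lemma expmxD X Y : comm_mx X Y -> expmx (X + Y) = expmx X *m expmx Y.
Proof.
move=> XY.
set x := d%:R * `|X|; set y := d%:R * `|Y|.
have cXY : (fun n => exp_sum X n *m exp_sum Y n) @ \oo --> expmx X *m expmx Y.
  by apply: cvg_mulmx; exact: cvg_expmx.
apply: (cvg_unique _ (@cvg_expmx (X + Y))) => //.
apply: cvg_sub0 cXY.
apply: norm_cvg0.
apply: (@squeeze_cvgr _ _ _ _ (fun=> 0) (fun n =>
  series (exp_coeff x) n * series (exp_coeff y) n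
    - series (exp_coeff (x + y)) n)).
- near=> n; rewrite normr_ge0 fctE distrC exp_sum_defect// exp_coeff_defect.
  apply: le_trans (ler_norm_sum _ _ _) _; apply: ler_sum => i _.
  apply: le_trans (ler_norm_sum _ _ _) _; apply: ler_sum => j _.
  rewrite normrZ ger0_norm ?mulr_ge0 ?invr_ge0//.
  rewrite ler_wpM2l ?mulr_ge0 ?invr_ge0//.
  apply: le_trans (mx_norm_exprM _ _ _) _.
  by rewrite ler_wpM2l ?mx_norm_expr// exprn_ge0 ?mulr_ge0.
- exact: cvg_cst.
- rewrite -[X in _ --> X](subrr (expR (x + y))) {1}expRD.
  by apply: cvgB; [apply: cvgM|]; exact: is_cvg_series_exp_coeff.
Unshelve. all: by end_near. Qed.

Lemma expmxMn X n : expmx (n%:R *: X) = expmx X ^+ n.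
Proof.
elim: n => [|n IH]; first by rewrite scale0r expmx0 expr0.
rewrite -addn1 natrD scalerDl scale1r expmxD ?IH; last first.
  by rewrite /comm_mx -scalemxAl -scalemxAr.
by rewrite addn1 exprSr mulmxE.
Qed.

End matrix_exponential.

(** * Operator norm of an arbitrary vector norm *)

Lemma lipschitz_continuous {R : realType} {V W : normedModType R} (f : V -> W)
    (C : R) : (forall x y, `|f x - f y| <= C * `|x - y|) -> continuous f.
Proof.
move=> fC x; apply/subr_cvg0; apply: norm_cvg0.
apply: (@squeeze_cvgr _ _ _ _ (fun=> 0) (fun y => C * `|y - x|)).
- by near=> y; rewrite normr_ge0 fC.
- exact: cvg_cst.
- have -> : 0 = C * `|x - x| by rewrite subrr normr0 mulr0.
  apply: cvgM; first exact: cvg_cst.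
  by apply: cvg_norm; apply: cvgB; [exact: cvg_id|exact: cvg_cst].
Unshelve. all: by end_near. Qed.

Section vector_norm.
Local Open Scope classical_set_scope.
Context {R : realType} {d : nat} {N : 'cV[R]_d -> R}.
Context (N_norm : is_vector_norm N).
Implicit Types (x y : 'cV[R]_d) (M P : 'M[R]_d).

Lemma vnorm0 : N 0 = 0.
Proof. by rewrite -[0](scale0r 0) (vector_normZ N_norm) normr0 mul0r. Qed.

Lemma vnormN x : N (- x) = N x.
Proof. by rewrite -scaleN1r (vector_normZ N_norm) normrN1 mul1r. Qed.

Lemma vnorm_ge0 x : 0 <= N x.
Proof.
have := vector_norm_triangle N_norm x (- x).
by rewrite subrr vnorm0 vnormN -mulr2n pmulrn_lge0.
Qed.

Lemma vnorm_sum {I : Type} (r : seq I) (F : I -> 'cV[R]_d) :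
  N (\sum_(i <- r) F i) <= \sum_(i <- r) N (F i).
Proof.
elim/big_rec2: _ => [|i y x _ xy]; first by rewrite vnorm0.
by apply: le_trans (vector_norm_triangle N_norm _ _) _; rewrite lerD2l.
Qed.

(** The easy half of the equivalence of norms: expand [x] on the standard
    basis. *)
Lemma vnorm_le_mx_norm :
  exists2 C : R, 0 <= C & forall x, N x <= C * `|x|.
Proof.
exists (\sum_(i < d) N (delta_mx i 0)).
  by apply: sumr_ge0 => i _; exact: vnorm_ge0.
move=> x; have {1}-> : x = \sum_(i < d) x i 0 *: delta_mx i 0.
  by rewrite {1}[x]matrix_sum_delta; apply: eq_bigr => i _; rewrite big_ord1.
apply: le_trans (vnorm_sum _ _) _; rewrite mulr_suml; apply: ler_sum => i _.
by rewrite (vector_normZ N_norm) mulrC ler_wpM2l ?vnorm_ge0 ?mx_norm_entry_le.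
Qed.

Lemma vnorm_lipschitz :
  exists C : R, forall x y, `|N x - N y| <= C * `|x - y|.
Proof.
have [C C0 NC] := vnorm_le_mx_norm; exists C => x y.
apply: le_trans _ (NC _).
have le_sub u v : N u - N v <= N (u - v).
  by rewrite lerBlDr -{1}[u](subrK v) (vector_norm_triangle N_norm).
by rewrite ler_norml le_sub andbT lerNl opprB -[leRHS]vnormN opprB le_sub.
Qed.

Lemma vnorm_continuous : continuous N.
Proof. by have [C NC] := vnorm_lipschitz; exact: lipschitz_continuous NC. Qed.

(** The other half: the continuous function [N] attains its minimum on the
    compact unit sphere of the maximum norm, and this minimum is positive since
    [N] is definite. The sphere is taken among row vectors, the
    setting of [bounded_closed_compact] and [EVT_min_rV]. *)
Lemma mx_norm_le_vnorm :
  exists2 c : R, 0 < c & forall x, c * `|x| <= N x.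
Proof.
pose S := [set v : 'rV[R]_d | `|v| = 1].
have unitS x : x != 0 -> S (`|x|^-1 *: x)^T.
  move=> x0; rewrite /S /= mx_norm_trmx normrZ normfV normr_id.
  by rewrite mulVf ?normr_eq0.
(* The sphere is empty in dimension 0, where any constant will do. *)
have [[v0 Sv0]|S0] := pselect (S !=set0); last first.
  exists 1 => [//|x]; have [->|/unitS Sx] := eqVneq x 0.
    by rewrite normr0 mulr0 vnorm0.
  by case: S0; exists (`|x|^-1 *: x)^T.
have cS : compact S.
  apply: bounded_closed_compact.
    by exists 1; split => // r r1 v /= ->; exact: ltW.
  apply: (@preimage_closed _ _ (fun v : 'rV[R]_d => `|v|) [set 1]).
    by move=> v _; exact: norm_continuous.
  exact: closed_eq.
have cN : {within S, continuous (fun v : 'rV[R]_d => N v^T)}.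
  apply: continuous_subspaceT => v.
  have [C NC] := vnorm_lipschitz.
  apply: (@lipschitz_continuous _ _ _ _ C) => {}v w.
  by apply: le_trans (NC _ _) _; rewrite -linearB mx_norm_trmx.
have [v Sv vmin] := EVT_min_rV (ex_intro _ v0 Sv0) cS cN.
exists (N v^T) => [|x].
  rewrite lt_neqAle vnorm_ge0 andbT eq_sym; apply/eqP.
  move=> /(vector_norm_definite N_norm)/(congr1 trmx).
  rewrite trmxK trmx0 => v_0.
  by move: Sv; rewrite inE /S /= v_0 normr0 => /esym/eqP; rewrite oner_eq0.
have [->|x0] := eqVneq x 0; first by rewrite normr0 mulr0 vnorm0.
have /vmin : (`|x|^-1 *: x)^T \in S by rewrite inE; exact: unitS.
rewrite trmxK (vector_normZ N_norm) normfV normr_id mulrC.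
by rewrite ler_pdivlMr ?normr_gt0.
Qed.

(** The supremum of a set without upper bound is 0 by convention, so every
    property of [opnorm] rests on this bound. *)
Lemma has_ubound_opnorm M :
  has_ubound [set N (M *m x) | x in [set x | N x <= 1]].
Proof.
have [C C0 NC] := vnorm_le_mx_norm; have [c c0 Nc] := mx_norm_le_vnorm.
exists (C * (d%:R * `|M| * c^-1)) => _ [x /= x1 <-].
apply: le_trans (NC _) _; rewrite ler_wpM2l//.
apply: le_trans (mx_norm_mulmx _ _) _; rewrite ler_wpM2l ?mulr_ge0//.
by rewrite -[leRHS]mul1r ler_pdivlMr// mulrC (le_trans (Nc x)).
Qed.

Lemma opnorm_ge0 M : 0 <= opnorm N M.
Proof.
apply: (ub_le_sup (has_ubound_opnorm M)).
by exists 0; rewrite /= ?mulmx0 vnorm0.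
Qed.

Lemma vnorm_mulmx M x : N (M *m x) <= opnorm N M * N x.
Proof.
have [->|x0] := eqVneq x 0; first by rewrite mulmx0 vnorm0 mulr0.
have Nx : 0 < N x.
  rewrite lt_neqAle vnorm_ge0 andbT eq_sym.
  by apply: contra_neq x0; exact: (vector_norm_definite N_norm).
rewrite -ler_pdivrMr// mulrC -[(N x)^-1]gtr0_norm ?invr_gt0//.
rewrite -(vector_normZ N_norm) scalemxAr.
apply: (ub_le_sup (has_ubound_opnorm M)); exists ((N x)^-1 *: x) => //=.
by rewrite (vector_normZ N_norm) gtr0_norm ?invr_gt0// mulVf// gt_eqF.
Qed.

(** Since [opnorm] is the least Lipschitz constant of a matrix, each algebraic
    bound below follows from the same bound on vectors. *)
Lemma opnorm_le M c : 0 <= c -> (forall x, N (M *m x) <= c * N x) ->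
  opnorm N M <= c.
Proof.
move=> c0 Mc; apply: ge_sup.
  by exists (N (M *m 0)), 0; rewrite //= vnorm0.
move=> _ [x /= x1 <-]; apply: le_trans (Mc x) _.
by rewrite -[leRHS]mulr1 ler_wpM2l.
Qed.

Lemma opnorm1 : opnorm N 1%:M <= 1.
Proof. by apply: opnorm_le => // x; rewrite mul1mx mul1r. Qed.

Lemma opnormD M P : opnorm N (M + P) <= opnorm N M + opnorm N P.
Proof.
apply: opnorm_le => [|x]; first by rewrite addr_ge0 ?opnorm_ge0.
rewrite mulmxDl mulrDl.
apply: le_trans (vector_norm_triangle N_norm _ _) _.
by rewrite lerD ?vnorm_mulmx.
Qed.

Lemma opnormZ a M : opnorm N (a *: M) <= `|a| * opnorm N M.
Proof.
apply: opnorm_le => [|x]; first by rewrite mulr_ge0 ?opnorm_ge0.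
by rewrite -scalemxAl (vector_normZ N_norm) -mulrA ler_wpM2l ?vnorm_mulmx.
Qed.

Lemma opnormM M P : opnorm N (M *m P) <= opnorm N M * opnorm N P.
Proof.
apply: opnorm_le => [|x]; first by rewrite mulr_ge0 ?opnorm_ge0.
rewrite -mulmxA -mulrA; apply: le_trans (vnorm_mulmx _ _) _.
by rewrite ler_wpM2l ?opnorm_ge0 ?vnorm_mulmx.
Qed.

Lemma opnormX M k : opnorm N (M ^+ k) <= opnorm N M ^+ k.
Proof.
elim: k => [|k IH]; first by rewrite !expr0 opnorm1.
rewrite !exprS -mulmxE; apply: le_trans (opnormM _ _) _.
by rewrite ler_wpM2l ?opnorm_ge0.
Qed.

(** The series is bounded on vectors, so that only convergence in the
    entrywise topology and continuity of [N] on vectors are used. *)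
Lemma opnorm_expmx M : opnorm N (expmx M) <= expR (opnorm N M).
Proof.
apply: opnorm_le => [|x]; first exact: expR_ge0.
pose u n := series (fun k : nat => (k`!%:R : R)^-1 *: M ^+ k) n *m x.
have cu : u @ \oo --> expmx M *m x.
  by apply: cvg_mulmx; [exact: cvg_expmx|exact: cvg_cst].
have cNu : N \o u @ \oo --> N (expmx M *m x).
  by apply: continuous_cvg cu; exact: vnorm_continuous.
rewrite -(cvg_lim _ cNu)//; apply: limr_le.
  by apply/cvg_ex; exists (N (expmx M *m x)).
near=> n; rewrite /u /series /= mulmx_suml.
apply: le_trans (vnorm_sum _ _) _.
apply: (@le_trans _ _ (series (exp_coeff (opnorm N M)) n * N x)).
  rewrite /series /= mulr_suml; apply: ler_sum => k _.
  rewrite -scalemxAl (vector_normZ N_norm) ger0_norm ?invr_ge0//.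
  rewrite /exp_coeff /= mulrAC [leRHS]mulrC ler_wpM2l ?invr_ge0//.
  apply: le_trans (vnorm_mulmx _ _) _.
  by rewrite ler_wpM2r ?vnorm_ge0 ?opnormX.
rewrite ler_wpM2r ?vnorm_ge0//; apply: nondecreasing_cvgn_le.
  apply: nondecreasing_series => k _ _.
  by apply: exp_coeff_ge0; exact: opnorm_ge0.
exact: is_cvg_series_exp_coeff.
Unshelve. all: by end_near. Qed.

(** Telescoping, one factor at a time:
    [M^(n+1) - P^(n+1) = M (M^n - P^n) + (M - P) P^n]. The sharp exponent of
    [r] is [n - 1]; as [1 <= r], the exponent [n] avoids a predecessor. *)
Lemma opnorm_exprB M P (r : R) n :
  1 <= r -> opnorm N M <= r -> opnorm N P <= r ->
  opnorm N (M ^+ n - P ^+ n) <= n%:R * opnorm N (M - P) * r ^+ n.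
Proof.
move=> r1 Mr Pr; have r0 : 0 <= r by exact: le_trans r1.
elim: n => [|n IH].
  rewrite !expr0 subrr !mul0r; apply: opnorm_le => // x.
  by rewrite mul0mx vnorm0 mul0r.
have -> : M ^+ n.+1 - P ^+ n.+1 = M *m (M ^+ n - P ^+ n) + (M - P) *m P ^+ n.
  by rewrite mulmxBr mulmxBl !mulmxE -!exprS addrA subrK.
apply: le_trans (opnormD _ _) _.
apply: (@le_trans _ _ (r * (n%:R * opnorm N (M - P) * r ^+ n)
                       + opnorm N (M - P) * r ^+ n.+1)).
  apply: lerD; apply: le_trans (opnormM _ _) _.
    by rewrite ler_pM ?opnorm_ge0.
  rewrite ler_wpM2l ?opnorm_ge0// (le_trans (opnormX _ _))//.
  rewrite exprS (le_trans (lerXn2r n _ _ Pr)) ?nnegrE ?opnorm_ge0//.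
  by rewrite ler_peMl ?exprn_ge0.
by rewrite -natr1 exprS le_eqVlt; apply/orP; left; apply/eqP; ring.
Qed.

End vector_norm.

(** * Splitting a step along complementary projectors *)

Section split_powers.
Context {R : realType} {d : nat}.
Implicit Types S E G P Q : 'M[R]_d.

(** The step [W = P S P + E Q] intertwines: [W P = P (G + D)] with
    [D = P S P - E P], and [W Q = Q E]. Such relations pass to powers, so
    [W^n] and [E^n] agree after [Q], and after [P] they are [P (G + D)^n] and
    [P G^n]; it remains to sum over [P + Q = 1]. *)
Lemma split_powerB S E G P Q n :
  P *m P = P -> Q *m Q = Q -> P + Q = 1%:M ->
  P *m Q = 0 -> Q *m P = 0 -> comm_mx P E -> E *m P = P *m G ->
  (P *m S *m P + E *m Q) ^+ n - E ^+ n =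
  P *m ((G + (P *m S *m P - E *m P)) ^+ n - G ^+ n) :> 'M[R]_d.
Proof.
move=> PP QQ PQ1 PQ QP PE EP.
set D := P *m S *m P - E *m P; set W := P *m S *m P + E *m Q.
have QE : E *m Q = Q *m E.
  have -> : Q = 1%:M - P by rewrite -PQ1 addrC addKr.
  by rewrite mulmxBr mulmxBl mulmx1 mul1mx PE.
have WP : W *m P = P *m (G + D).
  rewrite /W /D mulmxDl -!mulmxA PP QP mulmx0 addr0 mulmxDr mulmxBr -EP.
  by rewrite !mulmxA PP PE -[E *m P *m P]mulmxA PP addrC subrK.
have WQ : W *m Q = Q *m E.
  by rewrite /W mulmxDl -!mulmxA PQ QQ !mulmx0 add0r.
rewrite -[LHS]mulmx1 -PQ1 mulmxDr !mulmxBl mulmxBr.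
rewrite (expr_intertwine _ _ _ n WP) (expr_intertwine _ _ _ n WQ).
rewrite (expr_intertwine _ _ _ n EP) (expr_intertwine _ _ _ n QE).
by rewrite subrr addr0.
Qed.

End split_powers.

(** * Global error bound *)


Theorem theorem4p3 (R : realType) (d : nat)
    (N : 'cV[R]_d -> R) (N_norm : is_vector_norm N)
    (A B0 : 'M[R]_d) (eps0 : R) (eps0_gt0 : 0 < eps0)
    (Ps Pf : R -> 'M[R]_d) (CP ML h0 Cl : R)
    (splitting : forall eps : R, 0 < eps <= eps0 ->
      let L := relax_gen A B0 eps in
      [/\ is_projector (Ps eps) /\ is_projector (Pf eps),
          Ps eps + Pf eps = 1%:M,
          Ps eps *m Pf eps = 0 /\ Pf eps *m Ps eps = 0 &
          comm_mx (Ps eps) L /\ comm_mx (Pf eps) L])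
    (projector_bound : forall eps : R, 0 < eps <= eps0 ->
      opnorm N (Ps eps) + opnorm N (Pf eps) <= CP)
    (slow_bound : forall eps : R, 0 < eps <= eps0 ->
      opnorm N (Ps eps *m relax_gen A B0 eps *m Ps eps) <= ML)
    (h0_gt0 : 0 < h0) (Cl_gt0 : 0 < Cl)
    (step_defined : forall h eps : R, 0 < h <= h0 -> 0 < eps <= eps0 ->
      base_step_defined h A (eps^-1 *: B0))
    (slow_defect : forall h eps : R, 0 < h <= h0 -> 0 < eps <= eps0 ->
      opnorm N (Ps eps *m relax_step A B0 h eps *m Ps eps
                - expmx (h *: relax_gen A B0 eps) *m Ps eps)
      <= Cl * h ^+ 5) :
  forall T : R, 0 < T ->
  exists CT : R, forall h eps : R, 0 < h <= h0 -> 0 < eps <= eps0 ->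
    forall (U0 : 'cV[R]_d) (n : nat), n%:R * h <= T ->
      N (sfrc_step A B0 Ps Pf h eps ^+ n *m U0
         - expmx ((n%:R * h) *: relax_gen A B0 eps) *m U0)
      <= CT * h ^+ 4 * N U0.
Proof.
move=> T T_gt0.
have ML0 : 0 <= ML.
  have eps0_in : 0 < eps0 <= eps0 by rewrite eps0_gt0 lexx.
  exact: le_trans (opnorm_ge0 N_norm _) (slow_bound _ eps0_in).
pose M := ML + Cl * h0 ^+ 4.
have M0 : 0 <= M by rewrite addr_ge0// mulr_ge0// ?exprn_ge0// ltW.
exists (CP * T * Cl * expR (T * M)) => h eps hI epsI U0 n nhT.
have /andP[h_gt0 hh0] := hI.
have [[PP QQ] PQ1 [PQ QP] [PL _]] := splitting _ epsI.
have Ps_le : opnorm N (Ps eps) <= CP.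
  apply: le_trans _ (projector_bound _ epsI).
  by rewrite lerDl opnorm_ge0.
have CP0 : 0 <= CP by exact: le_trans (opnorm_ge0 N_norm _) Ps_le.
set L := relax_gen A B0 eps in PL *.
set P := Ps eps in PP PQ1 PQ QP PL Ps_le *.
set Q := Pf eps in QQ PQ1 PQ QP *.
set E := expmx (h *: L).
set Ls := P *m L *m P; set G := expmx (h *: Ls).
set D := P *m relax_step A B0 h eps *m P - E *m P.
have LP : L *m P = P *m Ls by rewrite /Ls !mulmxA PP PL -mulmxA PP.
have PE : comm_mx P E.
  apply/esym/expmx_intertwine.
  by rewrite -scalemxAl -scalemxAr PL.
have EP : E *m P = P *m G.
  by apply: expmx_intertwine; rewrite -scalemxAl -scalemxAr LP.
have D_le : opnorm N D <= Cl * h ^+ 5 by exact: slow_defect.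
have hM0 : 0 <= h * M by rewrite mulr_ge0// ltW.
have rho1 : 1 <= expR (h * M) by rewrite -expR0 ler_expR.
have G_le : opnorm N G <= expR (h * ML).
  apply: le_trans (opnorm_expmx N_norm _) _; rewrite ler_expR.
  apply: le_trans (opnormZ N_norm _ _) _.
  by rewrite gtr0_norm// ler_pM2l//; exact: slow_bound.
have G_rho : opnorm N G <= expR (h * M).
  apply: le_trans G_le _; rewrite ler_expR ler_pM2l// lerDl.
  by rewrite mulr_ge0// ?exprn_ge0// ltW.
(* The defect is absorbed in the rate, for x, y >= 0, through
   e^x + y <= e^x (1 + y) <= e^(x + y); hence the summand Cl h0^4 of M. *)
have GD_rho : opnorm N (G + D) <= expR (h * M).
  apply: le_trans (opnormD N_norm _ _) _; apply: le_trans (lerD G_le D_le) _.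
  set y := h * (Cl * h0 ^+ 4).
  have y_ge : Cl * h ^+ 5 <= y.
    rewrite /y exprS mulrCA ler_pM2l// ler_pM2l//.
    by apply: lerXn2r => //; rewrite nnegrE ltW.
  have y0 : 0 <= y by rewrite /y !mulr_ge0// ?exprn_ge0// ltW.
  have e1 : 1 <= expR (h * ML) by rewrite -expR0 ler_expR mulr_ge0// ltW.
  rewrite mulrDr -/y expRD.
  apply: (@le_trans _ _ (expR (h * ML) * (1 + y))); last first.
    by rewrite ler_pM2l ?expR_gt0// expR_ge1Dx.
  by rewrite mulrDr mulr1 lerD2l (le_trans y_ge)// ler_peMl.
rewrite -scalerA expmxMn -/E -mulmxBl.
rewrite /sfrc_step -/P -/Q -/L -/E (split_powerB _ _ G)// -/D.
apply: le_trans (vnorm_mulmx N_norm _ _) _; rewrite ler_wpM2r ?vnorm_ge0//.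
apply: le_trans (opnormM N_norm _ _) _; rewrite -!mulrA.
apply: ler_pM; rewrite ?opnorm_ge0//.
apply: le_trans (opnorm_exprB N_norm _ _ _ n rho1 GD_rho G_rho) _.
rewrite addrC addKr -expRM_natl.
have -> : T * (Cl * (expR (T * M) * h ^+ 4)) =
  T * (Cl * h ^+ 4) * expR (T * M) by ring.
apply: ler_pM; rewrite ?mulr_ge0 ?opnorm_ge0 ?expR_ge0//; last first.
  by rewrite ler_expR mulrA ler_wpM2r.
apply: (@le_trans _ _ (n%:R * (Cl * h ^+ 5))); first by rewrite ler_wpM2l.
rewrite exprS (_ : n%:R * _ = n%:R * h * (Cl * h ^+ 4)); last by ring.
by rewrite ler_wpM2r// mulr_ge0// ?exprn_ge0// ltW.
Qed.
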